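(* For every integer $n\geq 1$, the triangular grid $T_n$ satisfies $$\sigma_T(T_n)=\left\lceil\frac{2n}{3}\right\rceil+1.$$
   Context: All graphs are finite and simple. For a connected graph $G$ (with at least one edge) and a spanning tree $T$ of $G$, let $d_T(u,v)$ be the distance between $u$ and $v$ in $T$. The stretch of $T$ is $\sigma_T(G,T):=\max_{uv\in E(G)} d_T(u,v)$, and the tree-stretch of $G$ is $\sigma_T(G):=\min\{\sigma_T(G,T): T \text{ is a spanning tree of } G\}$ (the subscript $T$ in $\sigma_T(G)$ is part of the notation and does not refer to a particular tree). The triangular grid $T_n$ is the graph with vertex set $\{(x,y)\in\mathbb{Z}^2: x+y\leq n,\ x,y\geq 0\}$ in which two vertices $(x,y)$ and $(x',y')$ are adjacent if and only if either $|x-x'|+|y-y'|=1$, or both $|x-x'|+|y-y'|=2$ and $x+y=x'+y'$. (So $T_1$ is a triangle.) *)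

(* Defs.v *)
From mathcomp Require Import all_boot all_order all_algebra.

Set Implicit Arguments.
Unset Strict Implicit.
Unset Printing Implicit Defensive.

Import IntDist.

Record sgraph := SGraph {
  vertex :> finType;
  adj : rel vertex;
  adj_sym : symmetric adj;
  adj_irrefl : irreflexive adj
}.

Section Walks.
Variables (V : finType) (r : rel V).

Definition connectedb : bool := [forall x, forall y, connect r x y].

(* A cycle is a cyclic sequence of at least three distinct vertices; the bound
   on its length only serves to make the predicate decidable (see acyclicP).
   For irreflexive symmetric r, the cyclic sequences of length at most two are
   the empty one and the edges run back and forth. *)
Definition acyclicb : bool :=
  [forall k : 'I_#|V|.+1, forall c : k.-tuple V, ucycleb r c ==> (size c <= 2)].

Definition walkb (x y : V) (k : nat) : bool :=
  [exists p : k.-tuple V, path r x p && (last x p == y)].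

(* The default value #|V| is taken only when y is not reachable from x. *)
Definition dist (x y : V) : nat := \big[minn/#|V|]_(k < #|V| | walkb x y k) k.

End Walks.

Section TreeStretch.
Variable G : sgraph.

Definition edges : {set {set G}} := [set [set x; y] | x in G, y in G & adj x y].

(* Adjacency in the spanning subgraph of G with edge set F. *)
Definition edge_rel (F : {set {set G}}) : rel G := [rel x y | [set x; y] \in F].

Definition spanning_tree (F : {set {set G}}) : bool :=
  [&& F \subset edges, connectedb (edge_rel F) & acyclicb (edge_rel F)].

Definition stretch (F : {set {set G}}) : nat :=
  \max_(p : G * G | adj p.1 p.2) dist (edge_rel F) p.1 p.2.

(* stretch F <= #|G| always holds, so the default value #|G| does not affect
   the minimum as soon as G has a spanning tree (see tree_stretchP). *)
Definition tree_stretch : nat :=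
  \big[minn/#|G|]_(F : {set {set G}} | spanning_tree F) stretch F.

End TreeStretch.

Section TriangularGrid.
Variable n : nat.

Definition grid_vertex : finType :=
  {p : 'I_n.+1 * 'I_n.+1 | p.1 + p.2 <= n}.

Definition grid_adj : rel grid_vertex := fun u v =>
  let: (x, y) := val u in
  let: (x', y') := val v in
  (`|x - x'| + `|y - y'| == 1)
  || ((`|x - x'| + `|y - y'| == 2) && (x + y == x' + y' :> nat)).

Lemma grid_adj_sym : symmetric grid_adj.
Proof.
move=> [[x y] /= Hu] [[x' y'] /= Hv]; rewrite /grid_adj /=.
by rewrite (distnC x) (distnC y) [x + y == _]eq_sym.
Qed.

Lemma grid_adj_irrefl : irreflexive grid_adj.
Proof. by move=> [[x y] /= Hu]; rewrite /grid_adj /= !distnn. Qed.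

Definition triangular_grid : sgraph := SGraph grid_adj_sym grid_adj_irrefl.

End TriangularGrid.

Section BigMin.
Variables (I : finType) (P : pred I) (F : I -> nat) (m : nat).

Lemma bigminn_leq i : P i -> \big[minn/m]_(j | P j) F j <= F i.
Proof.
move=> Pi; have := mem_index_enum i; rewrite unlock.
elim: (index_enum I) => //= j s IHs; rewrite in_cons.
case/predU1P=> [<- | /IHs Hs]; first by rewrite Pi geq_minl.
by case: (P j) => //; apply: leq_trans Hs; apply: geq_minr.
Qed.

Lemma bigminn_attained :
  \big[minn/m]_(j | P j) F j = m
  \/ exists2 i, P i & \big[minn/m]_(j | P j) F j = F i.
Proof.
apply: (big_ind (fun k => k = m \/ exists2 i, P i & k = F i)).
- by left.
- by move=> a b Ha Hb; rewrite /minn; case: ifP.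
- by move=> i Pi; right; exists i.
Qed.

End BigMin.

Lemma acyclicP (V : finType) (r : rel V) :
  reflect (forall c : seq V, ucycle r c -> size c <= 2) (acyclicb r).
Proof.
apply: (iffP forallP) => [H c /[dup] /andP[_ Uc] Hc | H k].
  have Hs : size c < #|V|.+1 by rewrite ltnS -(card_uniqP Uc) max_card.
  by move/forallP/(_ (in_tuple c))/implyP: (H (Ordinal Hs)); apply.
by apply/forallP=> c; apply/implyP=> /H.
Qed.

Lemma walkP (V : finType) (r : rel V) x y k :
  reflect (exists p, [/\ path r x p, last x p = y & size p = k])
          (walkb r x y k).
Proof.
apply: (iffP existsP) => [[p /andP[Hp /eqP Hl]] | [p [Hp Hl Hs]]].
  by exists p; rewrite size_tuple.
have Hk : size p == k by apply/eqP.
by exists (Tuple Hk); rewrite /= Hp Hl eqxx.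
Qed.

Lemma dist_le_card (V : finType) (r : rel V) x y : dist r x y <= #|V|.
Proof.
have := bigminn_attained (fun k : 'I_#|V| => walkb r x y k) val #|V|.
by case=> [E | [i _ E]]; rewrite /dist E //= ltnW.
Qed.

Lemma dist_leq (V : finType) (r : rel V) x p :
  path r x p -> dist r x (last x p) <= size p.
Proof.
move=> Hp; have [Hs | Hs] := ltnP (size p) #|V|; last first.
  exact: leq_trans (dist_le_card _ _ _) Hs.
apply: (@bigminn_leq _ (fun k : 'I_#|V| => walkb r x (last x p) k) val _
  (Ordinal Hs)).
by apply/walkP; exists p.
Qed.

Lemma dist_attained (V : finType) (r : rel V) x y : connect r x y ->
  exists p, [/\ path r x p, last x p = y & size p = dist r x y].
Proof.
case/connectP=> p Hp ->; case/shortenP: Hp => q Hq Uq _.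
have Hs : size q < #|V| by rewrite -[_ < _]/(size (x :: q) <= _) -(card_uniqP Uq) max_card.
have Hd := dist_leq Hq.
move: (leq_ltn_trans Hd Hs); rewrite {Hd}/dist.
have := bigminn_attained (fun k : 'I_#|V| => walkb r x (last x q) k) val #|V|.
by case=> [-> | [i /walkP Hi ->] _] //; rewrite ltnn.
Qed.

Lemma stretch_le_card (G : sgraph) (F : {set {set G}}) : stretch F <= #|G|.
Proof. by apply/bigmax_leqP=> p _; apply: dist_le_card. Qed.

Lemma tree_stretchP (G : sgraph) (F0 : {set {set G}}) : spanning_tree F0 ->
  (exists2 F : {set {set G}}, spanning_tree F & stretch F = tree_stretch G)
  /\ (forall F : {set {set G}}, spanning_tree F -> tree_stretch G <= stretch F).
Proof.
move=> H0.
have Hle (F : {set {set G}}) : spanning_tree F -> tree_stretch G <= stretch F.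
  exact: bigminn_leq.
split=> //.
case: (bigminn_attained (@spanning_tree G) (@stretch G) #|G|) => [E | [F HF E]].
  exists F0 => //; apply/eqP; rewrite eqn_leq Hle // andbT.
  by rewrite /tree_stretch E stretch_le_card.
by exists F.
Qed.

(* Main.v *)
Require Import Defs.
From mathcomp Require Import all_boot all_order all_algebra.
From mathcomp Require Import zify.

Set Implicit Arguments.
Unset Strict Implicit.
Unset Printing Implicit Defensive.

(** Give the vertices of the triangular grid barycentric coordinates (a, b, c),
a + b + c = n; along an edge each coordinate, and each sum of two coordinates,
changes by at most 1. The value of the tree-stretch is (2n + 2) / 3 + 1, with
Euclidean division.

Lower bound. Let T be a spanning tree of stretch D, and let m be the median in T
of the three corners of the grid: deleting m from T leaves every corner that is
not m in a branch of its own ([median_exists]). Consider a side of the grid, say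
a = 0, on which m does not lie, and let x be the neighbour of m whose branch
contains one end Q of that side. The side is a path of the grid entering the
branch of x, so one of its edges uv has only v in this branch. The path of T
from u to v goes through m and x, and its part from u to m takes at least a(m)
steps, its part from x to v at least a(x), hence a(m) + a(x) + 1 <= D
([stretch_level]). If m does not lie on the side b = 0 that meets the first
one at Q either, then b(m) + b(x) + 1 <= D with the same x. But
a(x) + b(x) >= a(m) + b(m) - 1, so that adding up gives a(m) + b(m) + 1 <= D
([stretch_corner]). When m is an inner vertex the three corners together give
2n + 3 <= 3D, and boundary vertices m are even worse ([stretch_lower]).

Upper bound. Choose a central triangle (alpha + 1, beta, gamma),
(alpha, beta + 1, gamma), (alpha, beta, gamma + 1). Three spines b = beta,
c = gamma, a = alpha leave it like the arms of a pinwheel, each ending on a side,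
and parallel teeth run from each spine to the boundary, turning at the boundary
to fill the corner of the grid. The teeth of the three spines have lengths at
most beta, gamma and alpha, so that a fundamental cycle between neighbouring
teeth contributes a stretch of at most 2 beta + 1, 2 gamma + 1 and 2 alpha + 2,
where the last bound pays for the edge of the central triangle between the two
spine ends that are not joined directly ([dist_toward], [pinwheel_stretch]).
Balancing the three numbers, alpha being the smallest, matches the lower
bound. *)

(** * Distances *)

Section Distance.
Variables (V : finType) (r : rel V).

Lemma dist_edge x y : r x y -> dist r x y <= 1.
Proof.
by move=> rxy; apply: (@dist_leq _ r x [:: y]); rewrite /= rxy.
Qed.

Lemma dist_triangle y x z : connect r x y -> connect r y z ->
  dist r x z <= dist r x y + dist r y z.
Proof.
move=> /dist_attained[p [pP <- <-]] /dist_attained[q [qP <- <-]].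
by rewrite -last_cat -size_cat dist_leq // cat_path pP.
Qed.

Lemma dist_sym_le x y : symmetric r -> connect r x y ->
  dist r y x <= dist r x y.
Proof.
move=> symr /dist_attained[p [pP <- <-]].
have := @dist_leq _ r (last x p) (rev (belast x p)).
rewrite rev_path size_rev size_belast.
have -> : last (last x p) (rev (belast x p)) = x.
  by case: p {pP} => //= z p; rewrite rev_cons last_rcons.
by apply; rewrite (@eq_path _ _ r) // => a b /=; rewrite symr.
Qed.

End Distance.

(** * Branches of a tree at a vertex *)

Section Branches.
Variables (V : finType) (r : rel V).

Definition avoiding m : rel V := [rel x y | [&& r x y, x != m & y != m]].

(** Meaningful when x is a neighbour of m: it is then the component of x in
the tree with m deleted. *)
Definition branch m x : pred V := connect (avoiding m) x.

Lemma avoiding_path m x p : path (avoiding m) x p -> m \notin p.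
Proof.
elim: p x => //= y p IHp x /andP[/and3P[_ _ ym] /IHp mp].
by rewrite in_cons negb_or eq_sym ym.
Qed.

Lemma path_avoiding m x p : path r x p -> m \notin x :: p ->
  path (avoiding m) x p.
Proof.
elim: p x => //= y p IHp x /andP[rxy yp].
rewrite !in_cons !negb_or => /and3P[mx my mp]; rewrite /avoiding /=.
by rewrite rxy eq_sym mx eq_sym my IHp // in_cons negb_or my.
Qed.

Hypotheses (symr : symmetric r) (irrr : irreflexive r).
Hypothesis acyr : acyclicb r.

Lemma branch_sym m x y : branch m x y = branch m y x.
Proof.
by apply: sym_connect_sym => a b;
   rewrite /avoiding /= symr [(a != m) && _]andbC.
Qed.

Lemma branch_neq m x y : r m x -> branch m x y -> y != m.
Proof.
move=> rmx /connectP[p /avoiding_path mp ->].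
case/lastP: p mp => [_|p z] /=; last first.
  by rewrite last_rcons mem_rcons in_cons negb_or eq_sym => /andP[].
by apply/eqP=> xm; rewrite xm irrr in rmx.
Qed.

(** Two neighbours of m joined by a path that avoids m would close up with m
to a cycle. *)
Lemma branch_inj m x y z :
  r m x -> r m y -> branch m x z -> branch m y z -> x = y.
Proof.
move=> rmx rmy xz; rewrite branch_sym => zy.
have /connectP[p pP Dy] := connect_trans xz zy; subst y.
case/shortenP: pP rmy => q qP uq _ rmq.
have mq := avoiding_path qP.
have /(acyclicP _ acyr) : ucycle r (m :: x :: q).
  rewrite /ucycle cons_uniq uq in_cons negb_or mq [m == x]eq_sym.
  rewrite (branch_neq rmx (connect0 _ x)) /= rmx rcons_path symr rmq !andbT.
  by apply: sub_path qP => a b /and3P[].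
by case: q {uq zy xz rmq qP mq}.
Qed.

Section Lipschitz.
Variable f : V -> nat.
Hypothesis lip_f : forall x y, r x y -> f x <= f y + 1.

Lemma path_lip u p : path r u p -> f u <= size p + f (last u p).
Proof.
elim: p u => //= w p IHp u /andP[/lip_f fu /IHp]; lia.
Qed.

(** A walk that enters the branch at x does so along the edge from m to x. Up
to that edge it takes at least f m - f u steps, afterwards at least
f x - f (last u p). *)
Lemma crossing_size m x u p : r m x -> path r u p ->
  ~~ branch m x u -> branch m x (last u p) ->
  f m + f x + 1 <= size p + f u + f (last u p).
Proof.
move=> rmx; elim: p u => [|w p IHp] u /=; first by move=> _ /negP.
case/andP=> ruw pP xu xv.
have fw := lip_f (etrans (symr w u) ruw).
have [xw | xw] := boolP (branch m x w); last by have := IHp w pP xw xv; lia.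
have um : u = m.
  apply/eqP; apply: contraNT xu => um.
  apply: (connect_trans xw); apply: connect1; rewrite /avoiding /=.
  by rewrite symr ruw um (branch_neq rmx xw).
have wx : x = w.
  by rewrite um in ruw; apply: (branch_inj rmx ruw xw); apply: connect0.
by rewrite um -wx in pP *; have := path_lip pP; lia.
Qed.

End Lipschitz.

Hypothesis conr : connectedb r.

Lemma tree_connect x y : connect r x y.
Proof. by move/forallP/(_ x)/forallP: conr. Qed.

Lemma branch_exists m y : y != m ->
  exists x, [/\ r m x, branch m x y & dist r x y < dist r m y].
Proof.
have [p [pP <- <-]] := dist_attained (tree_connect m y).
case/shortenP: pP => [[|x q]] qP uq sub; first by rewrite eqxx.
move=> _; exists x; case/andP: qP => rmx qP.
have /andP[mxq uxq] : (m \notin x :: q) && uniq (x :: q) by [].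
split=> //=.
  by apply/connectP; exists q => //; apply: path_avoiding.
exact: leq_ltn_trans (dist_leq qP) (uniq_leq_size uxq sub).
Qed.

Lemma branch_closer m x y : r m x -> branch m x y -> dist r x y < dist r m y.
Proof.
move=> rmx xy.
have [x' [rmx' x'y lt]] := branch_exists (branch_neq rmx xy).
by rewrite (branch_inj rmx rmx' xy x'y).
Qed.

(** The median of A, B, C is the vertex with the least sum of distances to
them: if two of the three lay in the branch at x, a move from m to x would
bring these two nearer by 1 and take the third one at most 1 further away. *)
Lemma median_exists A B C : exists m, forall x, r m x ->
  branch m x A + branch m x B + branch m x C <= 1.
Proof.
pose s v := dist r v A + dist r v B + dist r v C.
case: (@arg_minnP _ A xpredT s) => // m _ min_m.
exists m => x rmx.
have le_x D : dist r x D <= (dist r m D).+1.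
  have := dist_triangle (tree_connect x m) (tree_connect m D).
  have : dist r x m <= 1 by rewrite dist_edge // symr.
  lia.
have:= min_m x isT; have:= le_x A; have:= le_x B; have:= le_x C.
rewrite /s => cC cB cA ms.
have := @branch_closer m x A rmx; have := @branch_closer m x B rmx.
have := @branch_closer m x C rmx.
by do 3![case: (branch m x _) => [/(_ isT) ?|_]]; lia.
Qed.

End Branches.

(** * Lower bounds on the stretch of a spanning tree *)

Definition level (G : sgraph) (f : G -> nat) : rel G :=
  [rel u v | [&& adj u v, f u == 0 & f v == 0]].

Lemma level_connect_sym (G : sgraph) (f : G -> nat) : connect_sym (level f).
Proof.
apply: sym_connect_sym => u v.
by rewrite /level /= adj_sym [(f u == 0) && _]andbC.
Qed.

Section SpanningTree.
Variables (G : sgraph) (F : {set {set G}}).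

Lemma edge_rel_sym : symmetric (edge_rel F).
Proof. by move=> x y; rewrite /edge_rel /= setUC. Qed.

Hypothesis treeF : spanning_tree F.

Lemma spanning_tree_adj x y : edge_rel F x y -> adj x y.
Proof.
case/and3P: treeF => /subsetP sub _ _ /sub /imset2P[a b _].
rewrite inE => /andP[_ ab] e.
have ba : adj b a by rewrite adj_sym.
have: x \in [set a; b] by rewrite -e set21.
have: y \in [set a; b] by rewrite -e set22.
have ne : a != b by apply: contraTneq ab => ->; rewrite adj_irrefl.
rewrite !inE => /pred2P[] Dy /pred2P[] Dx; move: e; rewrite Dx Dy // => e.
  have : b \in [set a; a] by rewrite e set22.
  by rewrite !inE orbb eq_sym (negPf ne).
have : a \in [set b; b] by rewrite e set21.
by rewrite !inE orbb (negPf ne).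
Qed.

Lemma edge_rel_irrefl : irreflexive (edge_rel F).
Proof.
by move=> x; apply/negP=> /spanning_tree_adj; rewrite adj_irrefl.
Qed.

Lemma edge_rel_connect x y : connect (edge_rel F) x y.
Proof. by case/and3P: treeF => _ conF _; apply: tree_connect. Qed.

Lemma dist_stretch x y : adj x y -> dist (edge_rel F) x y <= stretch F.
Proof.
move=> xy.
exact: (@leq_bigmax_cond _ (fun p => adj p.1 p.2)
          (fun p => dist (edge_rel F) p.1 p.2) (x, y)).
Qed.

(** A path of G at level 0 of f that enters the branch at x has an edge which
does so, and the tree path between the ends of this edge is long by
[crossing_size]. *)
Lemma stretch_level m x f P Q :
    (forall u v : G, adj u v -> f u <= f v + 1) ->
    edge_rel F m x -> connect (level f) P Q ->
    ~~ branch (edge_rel F) m x P -> branch (edge_rel F) m x Q ->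
  f m + f x + 1 <= stretch F.
Proof.
move=> lip_f mx /connectP[p pP ->{Q}].
elim: p P pP => [|v p IHp] u /=; first by move=> _ /negP.
case/andP=> /and3P[uv /eqP fu /eqP fv] pP xu xl.
have [xv | xv] := boolP (branch (edge_rel F) m x v); last exact: IHp v pP xv xl.
apply: leq_trans (dist_stretch uv).
have [q [qP lq <-]] := dist_attained (edge_rel_connect u v).
case/and3P: treeF => _ _ acyF.
have lipF a b : edge_rel F a b -> f a <= f b + 1 by move/spanning_tree_adj/lip_f.
have := crossing_size edge_rel_sym edge_rel_irrefl acyF lipF mx qP xu.
by rewrite lq fu fv !addn0; apply.
Qed.

Lemma stretch_side m f P Q :
    (forall u v : G, adj u v -> f u <= f v + 1) ->
    connect (level f) P Q -> Q != m ->
    (forall x, edge_rel F m x ->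
       branch (edge_rel F) m x P + branch (edge_rel F) m x Q <= 1) ->
  2 * f m <= stretch F.
Proof.
move=> lipf PQ Qm sep.
case/and3P: (treeF) => _ conF _.
have [x [mx xQ _]] := branch_exists conF Qm.
have := sep x mx; rewrite xQ => xP.
have := stretch_level lipf mx PQ _ xQ.
have := lipf _ _ (spanning_tree_adj mx).
lia.
Qed.

(** The step from m towards Q cannot decrease both f and g, so the bounds
that the two sides at Q yield for it are not attained together. *)
Lemma stretch_corner m f g P Q R :
    (forall u v : G, adj u v -> f u <= f v + 1) ->
    (forall u v : G, adj u v -> g u <= g v + 1) ->
    (forall u v : G, adj u v -> f u + g u <= f v + g v + 1) ->
    connect (level f) P Q -> connect (level g) R Q -> Q != m ->
    (forall x, edge_rel F m x ->
       branch (edge_rel F) m x P + branch (edge_rel F) m x Q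
         + branch (edge_rel F) m x R <= 1) ->
  f m + g m + 1 <= stretch F.
Proof.
move=> lipf lipg lipfg PQ RQ Qm sep.
case/and3P: (treeF) => _ conF _.
have [x [mx xQ _]] := branch_exists conF Qm.
have := sep x mx; rewrite xQ => xPR.
have := stretch_level lipf mx PQ _ xQ.
have := stretch_level lipg mx RQ _ xQ.
have := lipfg _ _ (spanning_tree_adj mx).
lia.
Qed.

End SpanningTree.

(** * Spanning trees given by a parent function *)

Section ParentTree.
Variables (G : sgraph) (root : G) (par : G -> G) (rank : G -> nat).
Hypothesis par_adj : forall v, v != root -> adj v (par v).
Hypothesis par_rank : forall v, v != root -> rank (par v) < rank v.

Definition parent_tree : {set {set G}} := [set [set v; par v] | v in predC1 root].

Lemma parent_edge v : v != root -> edge_rel parent_tree v (par v).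
Proof. by move=> vr; apply/imsetP; exists v. Qed.

Lemma parent_edgeE x y : edge_rel parent_tree x y ->
  x != root /\ y = par x \/ y != root /\ x = par y.
Proof.
case/imsetP=> v vr e.
have ne : v != par v.
  by apply: contraTneq (par_rank vr) => <-; rewrite ltnn.
have: x \in [set v; par v] by rewrite -e set21.
have: y \in [set v; par v] by rewrite -e set22.
rewrite !inE => /pred2P[] Dy /pred2P[] Dx; move: e; rewrite Dx Dy => e.
- have : par v \in [set v; v] by rewrite e set22.
  by rewrite !inE orbb eq_sym (negPf ne).
- by right.
- by left.
have : v \in [set par v; par v] by rewrite e set21.
by rewrite !inE orbb (negPf ne).
Qed.

(** The parent function leads from everywhere to the root; on a cycle, both
neighbours of a vertex of maximal rank would be its parent. *)
Lemma parent_tree_spanning : spanning_tree parent_tree.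
Proof.
have symT := edge_rel_sym parent_tree.
have to_root v : connect (edge_rel parent_tree) v root.
  have [k] := ubnP (rank v); elim: k v => // k IHk v lt_k.
  have [-> // | vr] := eqVneq v root.
  apply: connect_trans (connect1 (parent_edge vr)) (IHk _ _).
  exact: leq_trans (par_rank vr) lt_k.
apply/and3P; split.
- apply/subsetP=> _ /imsetP[v vr ->]; apply/imset2P.
  by exists v (par v); rewrite ?inE ?par_adj.
- apply/forallP=> x; apply/forallP=> y; apply: connect_trans (to_root x) _.
  by rewrite (sym_connect_sym symT) to_root.
apply/acyclicP=> c /andP[cycc uniqc]; rewrite leqNgt; apply/negP=> c3.
have [x0 x0c] : exists x, x \in c.
  by case: c c3 {cycc uniqc} => // x c _; exists x; rewrite mem_head.
case: (@arg_maxnP _ x0 (mem c) rank x0c) => x xc max_x.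
case: (rot_to xc) => i q Dq.
have: cycle (edge_rel parent_tree) (x :: q) by rewrite -Dq rot_cycle.
have: uniq (x :: q) by rewrite -Dq rot_uniq.
have: size (x :: q) > 2 by rewrite -Dq size_rot.
have memq y : y \in x :: q -> rank y <= rank x.
  by rewrite -Dq mem_rot => /max_x.
have up y : y \in x :: q -> edge_rel parent_tree x y -> y = par x.
  move=> yq /parent_edgeE[[] // | [yr Dx]].
  by have := par_rank yr; rewrite -Dx ltnNge memq.
case: q {Dq} memq up => // y q; case/lastP: q => // q z _ up _ uniq_q.
rewrite /= !rcons_path last_rcons => /and3P[xy _ zx].
have /up Dy : y \in x :: y :: rcons q z by rewrite !inE eqxx orbT.
have /up Dz : z \in x :: y :: rcons q z by rewrite !inE mem_rcons mem_head !orbT.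
by move: uniq_q; rewrite (Dy xy) (Dz _) 1?symT //= mem_rcons mem_head andbF.
Qed.

End ParentTree.

(** * Coordinates of the triangular grid *)

Section Grid.
Variable n : nat.
Local Notation T := (triangular_grid n).

Definition xc (v : T) : nat := (val v).1.
Definition yc (v : T) : nat := (val v).2.
Definition zc (v : T) : nat := n - xc v - yc v.

Lemma coord_sum v : xc v + yc v + zc v = n.
Proof. have := valP v; rewrite /zc /xc /yc /=; lia. Qed.

Lemma coord_inj u v : xc u = xc v -> yc u = yc v -> u = v.
Proof.
move=> ex ey; apply: val_inj.
by rewrite [val u]surjective_pairing [val v]surjective_pairing;
   congr pair; apply: val_inj.
Qed.

Definition vtx x y : T :=
  insubd (Sub (ord0, ord0) (leq0n n) : T) (inord x, inord y).

Lemma vtxE x y : x + y <= n -> xc (vtx x y) = x /\ yc (vtx x y) = y.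
Proof.
move=> le_n; have [lex ley] : x < n.+1 /\ y < n.+1 by lia.
have val_vtx : val (vtx x y) = (inord x, inord y).
  by rewrite val_insubd /= !inordK ?le_n.
by rewrite /xc /yc val_vtx /= !inordK.
Qed.

(** For f and g two of the three barycentric coordinates, this
orients every edge of the grid: of the six directions at u it selects
three, no two of them opposite. *)
Definition toward (f g : T -> nat) : rel T := [rel u v |
  [|| (f v == f u) && (g v == g u + 1), (f v == f u + 1) && (g v == g u)
    | (f v == f u + 1) && (g u == g v + 1)]].

Lemma adj_toward u v : adj u v = toward xc yc u v || toward xc yc v u.
Proof.
case: u v => [[a b] uP] [[c d] vP]; rewrite /toward /xc /yc /= /grid_adj /=.
by apply/idP/idP; lia.
Qed.

Lemma level_x_connect j : j <= n -> connect (level xc) (vtx 0 j) (vtx 0 0).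
Proof.
elim: j => // j IHj jn; apply: connect_trans (IHj _); last lia.
have [x1 y1] := @vtxE 0 j ltac:(lia).
have [x2 y2] := @vtxE 0 j.+1 ltac:(lia).
by apply: connect1; apply/and3P; rewrite adj_toward /toward /=; split; lia.
Qed.

Lemma level_y_connect j : j <= n -> connect (level yc) (vtx j 0) (vtx 0 0).
Proof.
elim: j => // j IHj jn; apply: connect_trans (IHj _); last lia.
have [x1 y1] := @vtxE j 0 ltac:(lia).
have [x2 y2] := @vtxE j.+1 0 ltac:(lia).
by apply: connect1; apply/and3P; rewrite adj_toward /toward /=; split; lia.
Qed.

Lemma level_z_connect j : j <= n -> connect (level zc) (vtx j (n - j)) (vtx 0 n).
Proof.
elim: j => [|j IHj] jn; first by rewrite subn0.
apply: connect_trans (IHj _); last lia.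
have [x1 y1] := @vtxE j (n - j) ltac:(lia).
have [x2 y2] := @vtxE j.+1 (n - j.+1) ltac:(lia).
by apply: connect1; apply/and3P; rewrite adj_toward /toward /zc /=; split; lia.
Qed.

(** With m the median of the corners, any two positive coordinates of m have
sum at most D - 1, where D is the stretch. If m has one coordinate 0, then the
other two already give n + 1 <= D; if m is a corner, then [stretch_side] gives
2n <= D. *)
Lemma stretch_lower F : 0 < n -> spanning_tree (G := T) F ->
  2 * n + 3 <= 3 * stretch F.
Proof.
move=> n0 treeF; case/and3P: (treeF) => _ conF acyF.
have [m sep] := median_exists (edge_rel_sym F) (edge_rel_irrefl treeF) acyF conF
  (vtx n 0) (vtx 0 n) (vtx 0 0).
have lip (u v : T) : adj u v ->
    [/\ xc u <= xc v + 1, yc u <= yc v + 1, zc u <= zc v + 1 &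
      [/\ xc u + yc u <= xc v + yc v + 1, yc u + zc u <= yc v + zc v + 1
       & xc u + zc u <= xc v + zc v + 1]].
  have := coord_sum u; have := coord_sum v.
  by rewrite adj_toward /toward /= => *; do !split; lia.
have [xX yX] := @vtxE n 0 ltac:(lia).
have [xY yY] := @vtxE 0 n ltac:(lia).
have [xZ yZ] := @vtxE 0 0 ltac:(lia).
have XZ := level_y_connect (leqnn n).
have YZ := level_x_connect (leqnn n).
have XY := level_z_connect (leqnn n); rewrite subnn in XY.
have YX : connect (level zc) (vtx 0 n) (vtx n 0) by rewrite level_connect_sym.
have ZX : connect (level yc) (vtx 0 0) (vtx n 0) by rewrite level_connect_sym.
have ZY : connect (level xc) (vtx 0 0) (vtx 0 n) by rewrite level_connect_sym.
have eqv (u v : T) : u = v -> xc u = xc v /\ yc u = yc v by move->.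
have corner f g P Q R := @stretch_corner _ _ treeF m f g P Q R.
have side f P Q := @stretch_side _ _ treeF m f P Q.
have cX : yc m > 0 -> zc m > 0 -> yc m + zc m + 1 <= stretch F.
  move=> my mz; apply: corner ZX YX _ _
    => [u v /lip[]|u v /lip[]|u v /lip[_ _ _ []]||x /sep] //; last by clear; lia.
  by apply/eqP=> /eqv; lia.
have cY : xc m > 0 -> zc m > 0 -> xc m + zc m + 1 <= stretch F.
  move=> mx mz; apply: corner ZY XY _ _
    => [u v /lip[]|u v /lip[]|u v /lip[_ _ _ []]||x /sep] //; last by clear; lia.
  by apply/eqP=> /eqv; lia.
have cZ : xc m > 0 -> yc m > 0 -> xc m + yc m + 1 <= stretch F.
  move=> mx my; apply: corner YZ XZ _ _
    => [u v /lip[]|u v /lip[]|u v /lip[_ _ _ []]||x /sep] //; last by clear; lia.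
  by apply/eqP=> /eqv; lia.
have sX : xc m > 0 -> 2 * xc m <= stretch F.
  move=> mx; apply: side YZ _ _ => [u v /lip[]||x /sep] //; last by clear; lia.
  by apply/eqP=> /eqv; lia.
have sY : yc m > 0 -> 2 * yc m <= stretch F.
  move=> my; apply: side XZ _ _ => [u v /lip[]||x /sep] //; last by clear; lia.
  by apply/eqP=> /eqv; lia.
have sZ : zc m > 0 -> 2 * zc m <= stretch F.
  move=> mz; apply: side XY _ _ => [u v /lip[]||x /sep] //; last by clear; lia.
  by apply/eqP=> Dm; rewrite -Dm /zc in mz; lia.
have := coord_sum m; lia.
Qed.

End Grid.

(** * Combs of parallel teeth *)

(** One arm of the pinwheel, described in coordinates (f, g, h) of its own: the
spine is g = beta, the teeth are the lines f = const below it, and a tooth that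
ends at the side h = 0 before it reaches the spine is continued along
that side. All vertices at the same height g are thus at the same distance from
the spine, and going from a tooth to the next one costs twice this distance,
plus the cost e of a step on the spine. *)
Section Comb.
Variables (n : nat) (r : rel (triangular_grid n)).
Hypotheses (symr : symmetric r) (conr : forall u v, connect r u v).
Variables (f g h : triangular_grid n -> nat).
Variable par : triangular_grid n -> triangular_grid n.
Variables (alpha beta e : nat).
Hypotheses (e_gt0 : 0 < e) (sum_fgh : forall u, f u + g u + h u = n).
Hypothesis inj_fg : forall u v, f u = f v -> g u = g v -> u = v.
Hypothesis par_inner : forall u, alpha <= f u -> g u < beta -> 0 < h u ->
  [/\ r u (par u), f (par u) = f u & g (par u) = g u + 1].
Hypothesis par_border : forall u, alpha <= f u -> g u < beta -> h u = 0 ->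
  [/\ r u (par u), f u = f (par u) + 1 & g (par u) = g u + 1].
Hypothesis spine : forall u v, alpha <= f u -> g u = beta -> g v = beta ->
  f v = f u + 1 -> dist r u v <= e.

Lemma dist_parents u v : r u (par u) -> r v (par v) ->
  dist r u v <= dist r (par u) (par v) + 2.
Proof.
move=> ru rv.
have := dist_triangle (conr u (par u)) (conr (par u) v).
have := dist_triangle (conr (par u) (par v)) (conr (par v) v).
have := dist_edge ru; have := @dist_edge _ r (par v) v; rewrite symr => /(_ rv).
lia.
Qed.

Lemma dist_rung u v : alpha <= f u -> g u <= beta -> g v = g u ->
  f v = f u + 1 -> dist r u v <= 2 * (beta - g u) + e.
Proof.
move Dk: (beta - g u) => k; elim: k u v Dk => [|k IHk] u v Dk au ub guv fuv.
  by rewrite muln0 add0n; apply: spine; lia.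
have := sum_fgh u; have := sum_fgh v => sv su.
have [ru fpu gpu] := @par_inner u au ltac:(lia) ltac:(lia).
have [hv0 | hv] := posnP (h v).
  have [rv fpv gpv] := @par_border v ltac:(lia) ltac:(lia) hv0.
  have puv : par u = par v by apply: inj_fg; lia.
  have := dist_triangle (conr u (par u)) (conr (par u) v).
  have := dist_edge ru; have := @dist_edge _ r (par v) v.
  by rewrite puv symr => /(_ rv); lia.
have [rv fpv gpv] := @par_inner v ltac:(lia) ltac:(lia) hv.
have := dist_parents ru rv.
have := IHk (par u) (par v); lia.
Qed.

Lemma dist_toward u v : toward f g u v ->
  alpha <= f u -> alpha <= f v -> g u <= beta -> g v <= beta ->
  dist r u v <= 2 * beta + e.
Proof.
have su := sum_fgh u; have sv := sum_fgh v.
case/or3P=> /andP[/eqP fv /eqP gv] au av ub vb.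
- have [ru fpu gpu] := @par_inner u au ltac:(lia) ltac:(lia).
  have -> : v = par u by apply: inj_fg; lia.
  by have := dist_edge ru; lia.
- by have := dist_rung au ub gv fv; lia.
(* On the third kind of edge, v is the lower end, and its parent is either u
   or the neighbour of u on the rung at height g u. *)
have [hv0 | hv] := posnP (h v).
  have [rv fpv gpv] := @par_border v ltac:(lia) ltac:(lia) hv0.
  have -> : u = par v by apply: inj_fg; lia.
  by have := @dist_edge _ r (par v) v; rewrite symr => /(_ rv); lia.
have [rv fpv gpv] := @par_inner v ltac:(lia) ltac:(lia) hv.
have := dist_triangle (conr u (par v)) (conr (par v) v).
have := @dist_edge _ r (par v) v; rewrite symr => /(_ rv).
have := @dist_rung u (par v); lia.
Qed.

End Comb.

(** * The pinwheel tree *)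

Section Pinwheel.
Variables (n alpha beta gamma : nat).
Hypothesis sum_thresholds : alpha + beta + gamma + 1 = n.
Local Notation T := (triangular_grid n).

(** Going cyclically through the comparisons of a, b, c with alpha, beta,
gamma, there is exactly one passage from a coordinate above its threshold to
one that is not: since a + b + c = n and alpha + beta + gamma = n - 1, neither
can all three be above nor can none be. The three branches are the three places of
this passage, with rules that arise from each other by rotation. The third
one sends the central vertex (alpha, beta, gamma + 1) to
(alpha, beta + 1, gamma), which would close a cycle around the central triangle;
this vertex is therefore made the root. *)
Definition pinwheel_step a b c : nat * nat :=
  if (alpha < a) && (b <= beta) then
    if b < beta then if 0 < c then (a, b.+1) else (a.-1, b.+1)
    else (a.-1, b)
  else if (beta < b) && (c <= gamma) then
    if c < gamma then if 0 < a then (a.-1, b) else (a, b.-1)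
    else (a.+1, b.-1)
  else
    if a < alpha then if 0 < b then (a.+1, b.-1) else (a.+1, b)
    else (a, b.+1).

Definition pinwheel_par (v : T) : T :=
  let p := pinwheel_step (xc v) (yc v) (zc v) in vtx n p.1 p.2.

(** The first two spines start at central vertices whose parents lie in other
arms; the offsets 1 and 2 make the rank decrease at these passages too. *)
Definition pinwheel_rank (v : T) : nat :=
  if (alpha < xc v) && (yc v <= beta) then xc v - alpha + (beta - yc v) + 1
  else if (beta < yc v) && (zc v <= gamma) then
    yc v - beta + (gamma - zc v) + 2
  else zc v - gamma + (alpha - xc v).

Definition pinwheel_root : T := vtx n alpha beta.

Lemma pinwheel_rootE : xc pinwheel_root = alpha /\ yc pinwheel_root = beta.
Proof. by apply: vtxE; lia. Qed.

Lemma pinwheel_root_neq v :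
  (v != pinwheel_root) = (xc v != alpha) || (yc v != beta).
Proof.
have [xr yr] := pinwheel_rootE; rewrite -negb_and; congr negb.
apply/eqP/andP=> [-> | [/eqP ex /eqP ey]]; first by rewrite xr yr.
by apply: coord_inj; rewrite ?xr ?yr.
Qed.

Lemma pinwheel_parE v : v != pinwheel_root ->
  let p := pinwheel_step (xc v) (yc v) (zc v) in
  xc (pinwheel_par v) = p.1 /\ yc (pinwheel_par v) = p.2.
Proof.
rewrite pinwheel_root_neq => vr; apply: vtxE; have := coord_sum v.
by rewrite /pinwheel_step; repeat case: ifPn => ? /=; lia.
Qed.

Lemma pinwheel_par_adj v : v != pinwheel_root -> adj v (pinwheel_par v).
Proof.
move=> vr; have := pinwheel_parE vr; have := coord_sum v.
have := coord_sum (pinwheel_par v).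
move: vr; rewrite pinwheel_root_neq adj_toward /toward /pinwheel_step.
by repeat case: ifPn => ? /=; lia.
Qed.

Lemma pinwheel_par_rank v : v != pinwheel_root ->
  pinwheel_rank (pinwheel_par v) < pinwheel_rank v.
Proof.
move=> vr; have := pinwheel_parE vr; have := coord_sum v.
have := coord_sum (pinwheel_par v).
move: vr; rewrite pinwheel_root_neq /pinwheel_rank /pinwheel_step.
by repeat case: ifPn => ? /=; lia.
Qed.

Definition pinwheel : {set {set T}} := parent_tree pinwheel_root pinwheel_par.

Lemma pinwheel_spanning : spanning_tree pinwheel.
Proof. exact: parent_tree_spanning pinwheel_par_adj pinwheel_par_rank. Qed.

Local Notation r := (edge_rel pinwheel).

Let symr : symmetric r := edge_rel_sym _.
Let conr u v : connect r u v := edge_rel_connect pinwheel_spanning u v.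

Lemma pinwheel_par_dist v : v != pinwheel_root ->
  dist r (pinwheel_par v) v <= 1.
Proof. by move=> vr; apply: dist_edge; rewrite symr; apply: parent_edge. Qed.

(** The region treated here includes the line a = alpha next to the first
arm. This line is the spine of the third arm, and its parents follow the rule
for the teeth of the first one, so that the comb argument also covers the edges
between the two arms. The same overlap occurs in the next two lemmas. *)
Lemma pinwheel_dist_xy u v : toward (@xc n) (@yc n) u v ->
    alpha <= xc u -> alpha <= xc v -> yc u <= beta -> yc v <= beta ->
  dist r u v <= 2 * beta + 1.
Proof.
apply: (@dist_toward n r symr conr _ _ (@zc n) pinwheel_par) => //.
- exact: coord_sum.
- exact: coord_inj.
- move=> w xw yw zw; have wr : w != pinwheel_root by rewrite pinwheel_root_neq; lia.
  split; first exact: parent_edge;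
    have := pinwheel_parE wr; rewrite /pinwheel_step;
    by repeat case: ifPn => ? /=; lia.
- move=> w xw yw zw; have wr : w != pinwheel_root by rewrite pinwheel_root_neq; lia.
  split; first exact: parent_edge;
    have := pinwheel_parE wr; have := coord_sum w; rewrite /pinwheel_step;
    by repeat case: ifPn => ? /=; lia.
move=> w w' xw yw yw' xw'.
have wr : w' != pinwheel_root by rewrite pinwheel_root_neq; lia.
have -> : w = pinwheel_par w'; last exact: pinwheel_par_dist.
have := pinwheel_parE wr; have := coord_sum w'; rewrite /pinwheel_step.
by repeat case: ifPn => ? /=; move=> *; apply: coord_inj; lia.
Qed.

Lemma pinwheel_dist_yz u v : toward (@yc n) (@zc n) u v ->
    beta <= yc u -> beta <= yc v -> zc u <= gamma -> zc v <= gamma ->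
  dist r u v <= 2 * gamma + 1.
Proof.
apply: (@dist_toward n r symr conr _ _ (@xc n) pinwheel_par) => //.
- by move=> w; have := coord_sum w; lia.
- by move=> w w' yw zw; have := coord_sum w; have := coord_sum w';
     move=> *; apply: coord_inj; lia.
- move=> w yw zw xw; have sw := coord_sum w.
  have wr : w != pinwheel_root by rewrite pinwheel_root_neq; lia.
  split; first exact: parent_edge;
    have := pinwheel_parE wr; have := coord_sum (pinwheel_par w);
    rewrite /pinwheel_step; by repeat case: ifPn => ? /=; lia.
- move=> w yw zw xw; have sw := coord_sum w.
  have wr : w != pinwheel_root by rewrite pinwheel_root_neq; lia.
  split; first exact: parent_edge;
    have := pinwheel_parE wr; have := coord_sum (pinwheel_par w);
    rewrite /pinwheel_step; by repeat case: ifPn => ? /=; lia.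
move=> w w' yw zw zw' yw'; have sw := coord_sum w; have sw' := coord_sum w'.
have wr : w' != pinwheel_root by rewrite pinwheel_root_neq; lia.
have -> : w = pinwheel_par w'; last exact: pinwheel_par_dist.
have := pinwheel_parE wr; rewrite /pinwheel_step.
by repeat case: ifPn => ? /=; move=> *; apply: coord_inj; lia.
Qed.

Lemma pinwheel_dist_zx u v : toward (@zc n) (@xc n) u v ->
    gamma <= zc u -> gamma <= zc v -> xc u <= alpha -> xc v <= alpha ->
  dist r u v <= 2 * alpha + 2.
Proof.
apply: (@dist_toward n r symr conr _ _ (@yc n) pinwheel_par) => //.
- by move=> w; have := coord_sum w; lia.
- by move=> w w' zw xw; have := coord_sum w; have := coord_sum w';
     move=> *; apply: coord_inj; lia.
- move=> w zw xw yw; have sw := coord_sum w.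
  have wr : w != pinwheel_root by rewrite pinwheel_root_neq; lia.
  split; first exact: parent_edge;
    have := pinwheel_parE wr; have := coord_sum (pinwheel_par w);
    rewrite /pinwheel_step; by repeat case: ifPn => ? /=; lia.
- move=> w zw xw yw; have sw := coord_sum w.
  have wr : w != pinwheel_root by rewrite pinwheel_root_neq; lia.
  split; first exact: parent_edge;
    have := pinwheel_parE wr; have := coord_sum (pinwheel_par w);
    rewrite /pinwheel_step; by repeat case: ifPn => ? /=; lia.
move=> w w' zw xw xw' zw'; have sw := coord_sum w; have sw' := coord_sum w'.
have [w'r | wr] := eqVneq w' pinwheel_root; last first.
  have -> : w = pinwheel_par w'; last first.
    by apply: leq_trans (pinwheel_par_dist wr) _.
  have := pinwheel_parE wr; move: wr; rewrite pinwheel_root_neq /pinwheel_step.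
  by repeat case: ifPn => ? /=; move=> *; apply: coord_inj; lia.
(* Next to the root the spine is interrupted; the detour goes through the third
   vertex of the central triangle. *)
have [xr yr] := pinwheel_rootE.
have wr : w != pinwheel_root by rewrite pinwheel_root_neq; subst w'; lia.
have [xp yp] : xc (pinwheel_par w) = alpha.+1 /\ yc (pinwheel_par w) = beta.
  have := pinwheel_parE wr; rewrite /pinwheel_step; subst w'.
  by repeat case: ifPn => ? /=; lia.
have pr : pinwheel_par w != pinwheel_root by rewrite pinwheel_root_neq; lia.
have Dw' : w' = pinwheel_par (pinwheel_par w).
  have := pinwheel_parE pr; have := coord_sum (pinwheel_par w).
  rewrite w'r /pinwheel_step.
  by repeat case: ifPn => ? /=; move=> *; apply: coord_inj; lia.
have := dist_triangle (conr w' (pinwheel_par w)) (conr _ w).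
have := pinwheel_par_dist wr; have := pinwheel_par_dist pr.
rewrite -Dw'; have := dist_sym_le symr (conr w' w); lia.
Qed.

(** The three overlapping regions of the preceding lemmas contain both ends of
every edge. *)
Lemma pinwheel_stretch :
  stretch pinwheel <= maxn (2 * alpha + 2) (2 * maxn beta gamma + 1).
Proof.
apply/bigmax_leqP => -[u v]; rewrite [_.1]/= [_.2]/=.
wlog dir : u v / toward (@xc n) (@yc n) u v.
  move=> th uv; move: (uv); rewrite adj_toward => /orP[dir | dir].
    exact: th.
  apply: leq_trans (dist_sym_le symr (conr v u)) (th v u dir _).
  by rewrite (@adj_sym T).
move=> _; have su := coord_sum u; have sv := coord_sum v.
have regions :
    [\/ [/\ alpha <= xc u, alpha <= xc v, yc u <= beta & yc v <= beta],
        [/\ beta <= yc u, beta <= yc v, zc u <= gamma & zc v <= gamma]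
      | [/\ gamma <= zc u, gamma <= zc v, xc u <= alpha & xc v <= alpha]].
  case/or3P: dir => /andP[/eqP xv /eqP yv];
    case: (ltngtP (yc u) beta) => ?; case: (ltngtP (xc u) alpha) => ?;
    case: (ltngtP (zc u) gamma) => ?;
    try (by apply: Or31; split; lia);
    try (by apply: Or32; split; lia);
    by apply: Or33; split; lia.
have dir_yz : toward (@yc n) (@zc n) u v || toward (@yc n) (@zc n) v u.
  by move: dir; rewrite /toward /=; lia.
have dir_zx : toward (@zc n) (@xc n) u v || toward (@zc n) (@xc n) v u.
  by move: dir; rewrite /toward /=; lia.
have symd := dist_sym_le symr (conr v u).
case: regions => -[u1 v1 u2 v2].
- by have := pinwheel_dist_xy dir u1 v1 u2 v2; lia.
- case/orP: dir_yz => /pinwheel_dist_yz.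
    by move=> /(_ u1 v1 u2 v2); lia.
  by move=> /(_ v1 u1 v2 u2); lia.
case/orP: dir_zx => /pinwheel_dist_zx.
  by move=> /(_ u1 v1 u2 v2); lia.
by move=> /(_ v1 u1 v2 u2); lia.
Qed.

End Pinwheel.

(** * The tree-stretch of the triangular grid *)

Lemma ceil_two_thirds n :
  (Num.ceil (2%:R * n%:R / 3%:R : rat) = Posz ((2 * n + 2) %/ 3))%R.
Proof.
apply: Num.Theory.ceil_def.
rewrite Num.Theory.ltr_pdivlMr // Num.Theory.ler_pdivrMr //.
rewrite GRing.rmorphB /= -!pmulrn -!GRing.natrM.
apply/andP; split; last by rewrite Num.Theory.ler_nat; lia.
rewrite GRing.mulrBl GRing.mul1r Num.Theory.ltrBlDr -GRing.natrM -GRing.natrD.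
by rewrite Num.Theory.ltr_nat; lia.
Qed.

Theorem theorem4p2 (n : nat) (hn : 1 <= n) :
  ((tree_stretch (triangular_grid n))%:Z
   = Num.ceil (2%:R * n%:R / 3%:R : rat) + 1)%R.
Proof.
rewrite ceil_two_thirds.
(* The thresholds q <= n - 1 - q - b <= b are as equal as their sum n - 1
   permits. *)
pose q := (n - 1) %/ 3; pose b := (n - q) %/ 2.
have sum_q : q + b + (n - 1 - q - b) + 1 = n by rewrite /b /q; lia.
have [[F treeF stretchF] min_stretch] := tree_stretchP (pinwheel_spanning sum_q).
have upper := leq_trans (min_stretch _ (pinwheel_spanning sum_q))
                        (pinwheel_stretch sum_q).
have lower := stretch_lower hn treeF.
by rewrite stretchF in lower; rewrite /b /q in upper; lia.
Qed.
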